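(* Let $H^\infty_E$ and $G^\infty_F$ be the spaces of smooth type functions described in the context. A linear mapping $f:H^\infty_E\to G^\infty_F$ is sequential if and only if $f$ is represented by an infinite tensor $(f_{kjli})$ of complex numbers, $k,j\in\mathbb{N}$, $1\le l\le d_j$, $1\le i\le g_k$, such that for any $u\in H^\infty_E$ and $v\in\widehat{G^\infty_F}$ we have $$\sum_{j=1}^\infty\sum_{l=1}^{d_j}|f_{kjli}|\,|\widehat u(j,l)|<\infty\quad\text{for all } k\in\mathbb{N},\ i=1,\dots,g_k,$$ and $$\sum_{k=1}^\infty\sum_{i=1}^{g_k}|v_{ki}|\,\Big|\sum_{j=1}^\infty\sum_{l=1}^{d_j}f_{kjli}\,\widehat u(j,l)\Big|<\infty .$$ Furthermore, in this case the adjoint mapping $\widehat f:\widehat{G^\infty_F}\to\widehat{H^\infty_E}$ defined by $\widehat f(v)=v\circ f$ is also sequential, it is represented by the transposed tensor, i.e. $$\widehat f(v)_{jl}=\sum_{k=1}^\infty\sum_{i=1}^{g_k}f_{kjli}\,v_{ki},\qquad v\in\widehat{G^\infty_F},\ j\in\mathbb{N},\ 1\le l\le d_j,$$ and $f$ and $\widehat f$ are related by $\langle f(u),v\rangle_{G^\infty_F}=\langle u,\widehat f(v)\rangle_{H^\infty_E}$ for all $u\in H^\infty_E$, $v\in\widehat{G^\infty_F}$.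
   Context: Let $\mathcal{H}$ be a separable complex Hilbert space with an orthonormal basis $\{e_{jl}: j\in\mathbb{N},\ 1\le l\le d_j\}$ ($d_j\in\mathbb{N}$ positive integers, $\mathbb{N}=\{1,2,\dots\}$), and let $0<\lambda_1\le\lambda_2\le\cdots$ satisfy $\sum_{j}d_j\lambda_j^{-s_0}<\infty$ for some $s_0>0$. The associated operator is $E\phi=\sum_j\sum_l\lambda_j(\phi,e_{jl})_{\mathcal{H}}e_{jl}$; it serves only to label the spaces. For $\phi\in\mathcal{H}$ put $\widehat\phi(j,l)=(\phi,e_{jl})_{\mathcal{H}}$ and $\|\widehat\phi(j)\|_{\mathtt{HS}}^2=\sum_{l=1}^{d_j}|\widehat\phi(j,l)|^2$, and let $$H^\infty_E=\Big\{\phi\in\mathcal{H}:\ \sum_{j=1}^\infty\lambda_j^{2s}\|\widehat\phi(j)\|_{\mathtt{HS}}^2<\infty\ \text{for all }s\in\mathbb{R}\Big\},$$ identified with the space of coefficient sequences $(\widehat\phi(j,l))_{j\in\mathbb{N},1\le l\le d_j}$. Likewise let $\mathcal{G}$ be a separable complex Hilbert space with an orthonormal basis $\{h_{ki}: k\in\mathbb{N},\ 1\le i\le g_k\}$ ($g_k\in\mathbb{N}$), let $0<\mu_1\le\mu_2\le\cdots$ satisfy $\sum_k g_k\mu_k^{-s_0'}<\infty$ for some $s_0'>0$, let $F$ be the associated operator, and define $G^\infty_F\subseteq\mathcal{G}$ in the same way (with $\mathcal{G},h_{ki},g_k,\mu_k$ in place of $\mathcal{H},e_{jl},d_j,\lambda_j$).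 For $f:H^\infty_E\to G^\infty_F$ write $f(u)_{ki}=(f(u),h_{ki})_{\mathcal{G}}$. A sequence space is a linear subspace $V$ of the space of all complex families indexed by a fixed countable index set (here the pairs $(j,l)$, respectively $(k,i)$). Its $\alpha$-dual $\widehat V$ is the set of all families $a$ on the same index set with $\sum|v_\iota||a_\iota|<\infty$ for all $v\in V$, and the pairing is $\langle v,a\rangle_V=\sum_\iota v_\iota a_\iota$ (bilinear, absolutely convergent) for $v\in V$, $a\in\widehat V$. A functional $\phi:V\to\mathbb{C}$ is a sequential linear functional if there is $a\in\widehat V$ with $\phi(v)=\langle v,a\rangle_V$ for all $v\in V$; one then identifies $\phi$ with $a$ and writes $\phi\in\widehat V$ (conversely $a\in\widehat V$ is also regarded as a functional on $V$). A mapping $\phi:V\to W$ between sequence spaces is a sequential linear mapping if it is linear and for every $g\in\widehat W$ the composition $g\circ\phi:V\to\mathbb{C}$ is in $\widehat V$. ''$f$ is represented by the tensor $(f_{kjli})$'' means that $$f(u)_{ki}=\sum_{j=1}^\infty\sum_{l=1}^{d_j}f_{kjli}\,\widehat u(j,l)\qquad\text{for all } u\in H^\infty_E,\ k\in\mathbb{N},\ 1\le i\le g_k .$$ *)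

(* Defs.v *)
From HB Require Import structures.
From mathcomp Require Import all_boot all_order all_algebra.
From mathcomp Require Import complex.
From mathcomp Require Import all_classical all_reals all_analysis.
From mathcomp.analysis.showcase Require summability.

Set Implicit Arguments.
Unset Strict Implicit.
Unset Printing Implicit Defensive.

Import Order.TTheory GRing.Theory Num.Theory.
Import numFieldNormedType.Exports.

Local Open Scope classical_set_scope.
Local Open Scope ring_scope.

(* The real-valued modulus; `|z| would be an element of R[i]. *)
Notation cmod := ComplexField.Normc.normc.

(* [linear_for] and [linear] from ssralg only speak of maps that are linear on
   a whole module; here [phi] is only meaningful on the subspace [V]. *)
Definition linear_on (K : nzRingType) (X Y : lmodType K) (V : set X)
    (phi : X -> Y) : Prop :=
  forall (c : K) (u v : X), V u -> V v -> phi (c *: u + v) = c *: phi u + phi v.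

Definition sequence_space (R : realType) (I : countType) (V : set (I -> R[i])) :
    Prop :=
  submod_closed [in V].

Definition alpha_dual (R : realType) (I : countType) (V : set (I -> R[i])) :
    set (I -> R[i]) :=
  [set a | forall v, V v ->
    (\esum_(i in [set: I]) (cmod (v i) * cmod (a i))%:E < +oo)%E].

(* Unordered sum (limit along the finite subsets of I); R[i]^o is R[i] as a
   normed space over itself.  It is only used for v in V and a in the
   alpha-dual of V, where the sum converges absolutely. *)
Definition pairing (R : realType) (I : countType) (v a : I -> R[i]) : R[i] :=
  summability.sum (fun i => v i * a i : R[i]^o).

Definition sequential_functional (R : realType) (I : countType)
    (V : set (I -> R[i])) (phi : (I -> R[i]) -> R[i]) : Prop :=
  exists2 a, alpha_dual V a & forall v, V v -> phi v = pairing v a.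

(* A map V -> W is a function on all families, of which only the values on V
   matter. *)
Definition sequential_map (R : realType) (I J : countType)
    (V : set (I -> R[i])) (W : set (J -> R[i]))
    (phi : (I -> R[i]) -> (J -> R[i])) : Prop :=
  [/\ sequence_space V /\ sequence_space W,
      forall v, V v -> W (phi v),
      linear_on V phi
    & forall g, alpha_dual W g ->
        sequential_functional V (fun v => pairing (phi v) g)].

(* g |-> g o phi, where the functional g o phi on V is identified with the
   family in the alpha-dual of V that represents it. *)
Definition adjoint (R : realType) (I J : countType) (V : set (I -> R[i]))
    (phi : (I -> R[i]) -> (J -> R[i])) (g : J -> R[i]) : I -> R[i] :=
  xget 0 [set a | alpha_dual V a /\
                  forall v, V v -> pairing (phi v) g = pairing v a].

(* Double indices (j, l) with l < m j; both j and l are counted from 0. *)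

Definition idx (m : nat -> nat) := {j : nat & 'I_(m j)}.
HB.instance Definition _ (m : nat -> nat) := Countable.on (idx m).

Definition ix (m : nat -> nat) (j : nat) (l : 'I_(m j)) : idx m :=
  Tagged (fun j => 'I_(m j)) l.

(* n |-> \sum_(j < n) \sum_(l < m j) a j l *)
Definition dseries (R : realType) (m : nat -> nat)
    (a : forall j, 'I_(m j) -> R[i]) : nat -> R[i]^o :=
  series (fun j => \sum_(l < m j) a j l : R[i]^o).

Definition has_dsum (R : realType) (m : nat -> nat)
    (a : forall j, 'I_(m j) -> R[i]) (x : R[i]) : Prop :=
  dseries a @ \oo --> (x : R[i]^o).

Definition dsum (R : realType) (m : nat -> nat)
    (a : forall j, 'I_(m j) -> R[i]) : R[i] :=
  lim (dseries a @ \oo).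

Definition dsum_finite (R : realType) (m : nat -> nat)
    (a : forall j, 'I_(m j) -> R) : Prop :=
  (\sum_(j <oo) (\sum_(l < m j) a j l)%R%:E < +oo)%E.

(* A Hilbert space is a complete
    normed space over R[i] whose norm comes from an inner product, linear in
    its first argument; separability follows from the existence of a countable
    orthonormal basis. *)

Definition inner_product_of_norm (R : realType) (H : completeNormedModType R[i])
    (dot : {dot H for Num.conj}) : Prop :=
  forall x : H, dot x x = `|x| ^+ 2.

Definition orthonormal_basis (R : realType) (H : completeNormedModType R[i])
    (dot : {dot H for Num.conj}) (I : countType) (e : I -> H) : Prop :=
  (forall p q, dot (e p) (e q) = (p == q)%:R) /\
  closure [set x : H | exists (s : seq I) (c : I -> R[i]),
                         x = \sum_(p <- s) c p *: e p] = [set: H].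

Definition coef (R : realType) (H : completeNormedModType R[i])
    (dot : {dot H for Num.conj}) (m : nat -> nat) (e : idx m -> H)
    (phi : H) : idx m -> R[i] :=
  fun p => dot phi (e p).

Definition smooth (R : realType) (H : completeNormedModType R[i])
    (dot : {dot H for Num.conj}) (m : nat -> nat) (e : idx m -> H)
    (lambda : nat -> R) : set H :=
  [set phi | forall s : R,
    (\sum_(j <oo) (lambda j `^ (2 * s) *
       \sum_(l < m j) cmod (coef dot e phi (ix l)) ^+ 2)%R%:E < +oo)%E].

Definition smooth_coefs (R : realType) (H : completeNormedModType R[i])
    (dot : {dot H for Num.conj}) (m : nat -> nat) (e : idx m -> H)
    (lambda : nat -> R) : set (idx m -> R[i]) :=
  coef dot e @` smooth dot e lambda.

Definition admissible_weights (R : realType) (m : nat -> nat)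
    (lambda : nat -> R) : Prop :=
  [/\ forall j, (0 < m j)%N, forall j, 0 < lambda j, nondecreasing_seq lambda
    & exists2 s0 : R, 0 < s0 &
        (\sum_(j <oo) ((m j)%:R * lambda j `^ (- s0))%R%:E < +oo)%E].

(* The map between coefficient families that corresponds to f under the
   identification of smooth vectors with their coefficients: coef u |-> coef (f u)
   for u smooth. *)
Definition on_coefs (R : realType)
    (H : completeNormedModType R[i]) (dotH : {dot H for Num.conj})
    (d : nat -> nat) (e : idx d -> H) (lambda : nat -> R)
    (G : completeNormedModType R[i]) (dotG : {dot G for Num.conj})
    (g : nat -> nat) (h : idx g -> G) (f : H -> G) :
    (idx d -> R[i]) -> (idx g -> R[i]) :=
  fun c => coef dotG h
    (f (xget 0 [set u | smooth dotH e lambda u /\ coef dotH e u = c])).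

(* Main.v *)
Require Import Defs.
From HB Require Import structures.
From mathcomp Require Import all_boot all_order all_algebra.
From mathcomp Require Import complex.
From mathcomp Require Import finmap.
From mathcomp Require Import all_classical all_reals all_analysis.
From mathcomp.analysis.showcase Require summability.
From mathcomp Require Import ring lra.
Import Order.TTheory GRing.Theory Num.Theory.
Import numFieldNormedType.Exports.
Local Open Scope classical_set_scope.
Local Open Scope ring_scope.

(** The coefficient families of smooth vectors are the rapidly decreasing ones:
those whose product with every power of the eigenvalues is absolutely summable
([smooth_coefsE]).  A negative power of the eigenvalues is summable, so square
summability against all powers is the same as summability against all powers.
These families form a space that contains the unit families, is stable under
multiplication by bounded families and by powers of the eigenvalues, and equals
its second alpha-dual ([rapid_perfect]).

If the map on coefficients is sequential, pairing it with a unit family [(k, i)]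
gives the [(k, i)]-th coordinate as an element of the alpha-dual; these elements
are the rows of the tensor, and the summability conditions say that the rows lie
in the alpha-dual and that [f u] has coefficients in the target space.

The converse is the analytic part.  For [v] in the alpha-dual of the target, the
functional [L c], the sum of [(F c) q * v q] over [q], must be of the form
[pairing c a].  The only candidate is [a p = L (unit_fam p)], so two sums have to
be interchanged, and absolute summability of the double family is not among the
hypotheses.  Continuity of [L] replaces it, and comes from uniform boundedness.
Fix [c], let [lambda ^ (- s0)] be summable, put [w = lambda ^ s0 * c], and compose
[L] with the map sending a vector [x] of [H] to the family [w p * coef x p].  The
composite is a pointwise limit of partial sums over [q]; each of these is bounded
on [H] because every row lies in the alpha-dual, so the composite is bounded
([L_mulfam_bounded]).  The part of [c] outside a finite set is the image of a
vector whose norm is a tail of the series of the [lambda ^ (- s0)]; hence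
[L c] is the sum of [c p * a p] ([L_represented], [coordinatewise_sequential]).

Once the map is sequential, the statements on the adjoint are formal: its values
are found by pairing with unit families ([adjoint_coord]), and since the source is
perfect, every functional in its second alpha-dual is some [c], whose composite
with the adjoint is pairing with [F c] ([adjoint_sequential]). *)

(** * The modulus of complex numbers *)

Section Modulus.
Context {R : realType}.
Implicit Types z w : R[i].

Lemma cmod_norm z : `|z| = (cmod z)%:C%C.
Proof. by []. Qed.

Lemma gt0_complexE {z} : 0 < z -> z = (complex.Re z)%:C%C /\ 0 < complex.Re z.
Proof. by case: z => a b; rewrite ltcE /= => /andP[/eqP -> ->]. Qed.

Lemma cmod_ge0 z : 0 <= cmod z.
Proof. by case: z => a b /=; rewrite sqrtr_ge0. Qed.

Lemma cmodM z w : cmod (z * w) = cmod z * cmod w.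
Proof. exact: ComplexField.Normc.normcM. Qed.

Lemma cmodD z w : cmod (z + w) <= cmod z + cmod w.
Proof. exact: (@le_normcD R z w). Qed.

Lemma cmodN z : cmod (- z) = cmod z.
Proof. exact: (@normcN R z). Qed.

Lemma cmodB z w : cmod (z - w) = cmod (w - z).
Proof. by rewrite -cmodN opprB. Qed.

Lemma cmod0 : cmod (0 : R[i]) = 0.
Proof. exact: ComplexField.Normc.normc0. Qed.

Lemma cmod_real (r : R) : cmod r%:C%C = `|r|.
Proof. by rewrite /= expr0n addr0 sqrtr_sqr. Qed.

Lemma cmod_sum {J : Type} (s : seq J) (c : J -> R[i]) :
  cmod (\sum_(i <- s) c i) <= \sum_(i <- s) cmod (c i).
Proof.
elim/big_rec2: _ => [|i y1 y2 _ ih]; first by rewrite cmod0.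
by rewrite (le_trans (cmodD _ _)) ?lerD2l.
Qed.

Lemma cmod_eps0 z : (forall eps, 0 < eps -> cmod z <= eps) -> z = 0.
Proof.
move=> h; apply: ComplexField.Normc.eq0_normc; apply/eqP.
rewrite eq_le cmod_ge0 andbT; apply/ler_addgt0Pr => eps e0.
by rewrite add0r h.
Qed.

Lemma cmod_le_ReIm z : cmod z <= `|complex.Re z| + `|complex.Im z|.
Proof.
case: z => a b /=.
rewrite -(@ler_pXn2r _ 2) ?nnegrE ?sqrtr_ge0 ?addr_ge0//.
rewrite sqr_sqrtr ?addr_ge0 ?sqr_ge0// sqrrD !real_normK ?num_real//.
by rewrite addrAC lerDl mulrn_wge0 ?mulr_ge0.
Qed.

Lemma abs_Re_le_cmod z : `|complex.Re z| <= cmod z.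
Proof.
case: z => a b /=; rewrite -sqrtr_sqr ler_wsqrtr//.
by rewrite lerDl sqr_ge0.
Qed.

Lemma abs_Im_le_cmod z : `|complex.Im z| <= cmod z.
Proof.
case: z => a b /=; rewrite -sqrtr_sqr ler_wsqrtr//.
by rewrite lerDr sqr_ge0.
Qed.

End Modulus.

(** * Unordered sums *)

Section FiniteSums.
Context {R : realType} {I : choiceType}.
Implicit Types (a b : I -> R) (c : I -> R[i]) (A B D : {fset I}).

(** Convergence of the unordered sum, when [a] is nonnegative. *)
Definition fin_bdd a := exists M, forall A, \sum_(i <- A) a i <= M.

Lemma le_fin_bdd {a b} : (forall i, a i <= b i) -> fin_bdd b -> fin_bdd a.
Proof.
move=> ab [M bM]; exists M => A; apply: le_trans (bM A).
by apply: ler_sum => i _.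
Qed.

Lemma fin_bddD {a b} : fin_bdd a -> fin_bdd b -> fin_bdd (fun i => a i + b i).
Proof.
move=> [M aM] [N bN]; exists (M + N) => A.
by rewrite big_split/= lerD.
Qed.

Lemma fin_bddZ {k : R} {a} : 0 <= k -> fin_bdd a -> fin_bdd (fun i => k * a i).
Proof.
move=> k0 [M aM]; exists (k * M) => A.
by rewrite -mulr_sumr ler_wpM2l.
Qed.

Lemma fsum_mono {a A B} : (forall i, 0 <= a i) -> (A `<=` B)%fset ->
  \sum_(i <- A) a i <= \sum_(i <- B) a i.
Proof.
move=> a0 AB; rewrite [leRHS](big_fsetID _ (mem A))/=.
rewrite (_ : [fset x | x in B & x \in A]%fset = A); last first.
  apply/fsetP => x; rewrite !inE/= andbC.
  by case: (boolP (x \in A)) => //= /(fsubsetP AB).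
by rewrite lerDl sumr_ge0.
Qed.

Lemma fin_bdd_term {a} : (forall i, 0 <= a i) -> fin_bdd a ->
  exists2 M, 0 <= M & forall i, a i <= M.
Proof.
move=> a0 [M aM]; exists M; first by have := aM fset0; rewrite big_seq_fset0.
by move=> i; have := aM [fset i]%fset; rewrite big_seq_fset1.
Qed.

Lemma fin_bdd_sup {a} : (forall i, 0 <= a i) -> fin_bdd a ->
  exists2 s, (forall A, \sum_(i <- A) a i <= s) &
    forall eps, 0 < eps -> exists A, forall B, (A `<=` B)%fset ->
      s - eps <= \sum_(i <- B) a i.
Proof.
move=> a0 [M aM].
pose S := [set x : R | exists A, x = \sum_(i <- A) a i].
have S1 : has_sup S.
  split; first by exists 0, fset0; rewrite big_seq_fset0.
  by exists M => _ [A ->].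
exists (sup S) => [A|eps e0]; first by apply: ub_le_sup; [case: S1|exists A].
have [_ [A ->] hA] := sup_adherent e0 S1.
by exists A => B AB; apply: le_trans (ltW hA) (fsum_mono a0 AB).
Qed.

(** Finite sums that come within [eps] of the supremum leave at most [eps] to
all the other indices. *)
Lemma fin_bdd_tail {a} : (forall i, 0 <= a i) -> fin_bdd a ->
  forall eps, 0 < eps -> exists A, forall B, (A `<=` B)%fset ->
    forall D, \sum_(i <- D) (if i \in B then 0 else a i) <= eps.
Proof.
move=> a0 /(fin_bdd_sup a0)[s ub near_s] eps e0; have [A hA] := near_s _ e0.
exists A => B /hA {}hA D.
have hBD := ub (B `|` D)%fset.
rewrite (big_fsetID _ (mem B))/= in hBD.
have e1 : [fset x | x in (B `|` D)%fset & x \in B]%fset = B.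
  by apply/fsetP => x; rewrite !inE/= andbC; case: (x \in B).
rewrite e1 in hBD.
suff : \sum_(i <- D) (if i \in B then 0 else a i) <=
    \sum_(i <- [fset x | x in (B `|` D)%fset & x \notin B]%fset) a i.
  by move: hA hBD; lra.
rewrite (big_fsetID _ (mem B))/= big1_seq ?add0r; last first.
  by move=> i; rewrite !inE/= => /andP[_ ->].
apply: (@le_trans _ _ (\sum_(i <- [fset x | x in D & x \notin B]%fset) a i)).
  by apply: ler_sum => i _; case: ifP.
apply: fsum_mono => //; apply/fsubsetP => x; rewrite !inE/= => /andP[-> ->].
by rewrite orbT.
Qed.

Definition abs_summable c := fin_bdd (fun i => cmod (c i)).

Definition has_sum c (x : R[i]) := forall eps, 0 < eps ->
  exists A, forall B, (A `<=` B)%fset -> cmod (\sum_(i <- B) c i - x) <= eps.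

Definition tot c : R[i] := summability.sum (c : I -> R[i]^o).

Lemma has_sum_tot {c x} : has_sum c x -> tot c = x.
Proof.
move=> h; rewrite /tot /summability.sum.
apply: (@cvg_lim _ (@norm_hausdorff _ (R[i]^o : normedModType R[i])) _ _
  summability.totally_filter).
apply/(@cvgrPdist_le _ _ _ _ summability.totally_filter) => e e0.
have [eE e0'] := gt0_complexE e0.
have [A hA] := h _ e0'.
exists A => // B AB /=.
rewrite /summability.partial_sum eE.
rewrite -(big_seq_fsetE _ _ xpredT (c : I -> R[i]^o))/=.
by rewrite distrC cmod_norm lecR hA.
Qed.

Lemma has_sum_lin {c c' : I -> R[i]} {x y : R[i]} (k : R[i]) :
  has_sum c x -> has_sum c' y ->
  has_sum (fun i => k * c i + c' i) (k * x + y).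
Proof.
move=> h h' eps e0.
have k0 : 0 < cmod k + 1 by rewrite ltr_wpDl ?cmod_ge0.
have e2 : 0 < eps / 2 by lra.
have [A hA] := h (eps / 2 / (cmod k + 1)) (divr_gt0 e2 k0).
have [A' hA'] := h' (eps / 2) e2.
exists (A `|` A')%fset => B; rewrite fsubUset => /andP[/hA {}hA /hA' {}hA'].
rewrite big_split/= -mulr_sumr.
set s := \sum_(i <- B) c i in hA *; set s' := \sum_(i <- B) c' i in hA' *.
have -> : k * s + s' - (k * x + y) = k * (s - x) + (s' - y) by ring.
apply: le_trans (cmodD _ _) _; rewrite cmodM.
move: hA; rewrite ler_pdivlMr// => hA.
have := mulr_ge0 (cmod_ge0 k) (cmod_ge0 (s - x)); have := cmod_ge0 (s - x).
move: hA hA'; nra.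
Qed.

Lemma fin_bdd_lim {a} : (forall i, 0 <= a i) -> fin_bdd a ->
  exists s, forall eps, 0 < eps ->
    exists A, forall B, (A `<=` B)%fset -> `|\sum_(i <- B) a i - s| <= eps.
Proof.
move=> a0 /(fin_bdd_sup a0)[s ub near_s]; exists s => eps e0.
have [A hA] := near_s _ e0; exists A => B /hA {}hA.
have := ub B; have ? := ltW e0.
by rewrite ler_norml => hB; apply/andP; split; move: hA hB; lra.
Qed.

(** The nonnegative families [cmod c], [cmod c + Re c] and [cmod c + Im c] have
sums, and the real and imaginary parts of [c] are differences of them. *)
Lemma abs_summable_has_sum {c} : abs_summable c -> has_sum c (tot c).
Proof.
move=> sc; suff [x hx] : exists x, has_sum c x by rewrite (has_sum_tot hx).
have re0 i : 0 <= cmod (c i) + complex.Re (c i).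
  by have := abs_Re_le_cmod (c i); rewrite ler_norml => /andP[]; lra.
have im0 i : 0 <= cmod (c i) + complex.Im (c i).
  by have := abs_Im_le_cmod (c i); rewrite ler_norml => /andP[]; lra.
have [s1 h1] := fin_bdd_lim (fun i => cmod_ge0 (c i)) sc.
have [s2 h2] : exists s, forall eps, 0 < eps ->
    exists A, forall B, (A `<=` B)%fset ->
      `|\sum_(i <- B) (cmod (c i) + complex.Re (c i)) - s| <= eps.
  apply: fin_bdd_lim => //; apply: le_fin_bdd (fin_bddD sc sc) => i.
  by have := abs_Re_le_cmod (c i); rewrite ler_norml => /andP[]; lra.
have [s3 h3] : exists s, forall eps, 0 < eps ->
    exists A, forall B, (A `<=` B)%fset ->
      `|\sum_(i <- B) (cmod (c i) + complex.Im (c i)) - s| <= eps.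
  apply: fin_bdd_lim => //; apply: le_fin_bdd (fin_bddD sc sc) => i.
  by have := abs_Im_le_cmod (c i); rewrite ler_norml => /andP[]; lra.
exists (Complex (s2 - s1) (s3 - s1)) => eps e0.
have e4 : 0 < eps / 4 by lra.
have [A1 {}h1] := h1 _ e4; have [A2 {}h2] := h2 _ e4; have [A3 {}h3] := h3 _ e4.
exists (A1 `|` (A2 `|` A3))%fset => B.
rewrite !fsubUset => /and3P[/h1 {}h1 /h2 {}h2 /h3 {}h3].
apply: le_trans (cmod_le_ReIm _) _.
rewrite !raddfB/= !(raddf_sum (@complex.Re R : {additive R[i] -> R})).
rewrite !(raddf_sum (@complex.Im R : {additive R[i] -> R}))/=.
move: h1 h2 h3; rewrite !big_split/= !ler_norml.
move=> /andP[? ?] /andP[? ?] /andP[? ?].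
have : forall u v : R, `|u| <= eps / 2 -> `|v| <= eps / 2 -> `|u| + `|v| <= eps.
  by move=> u v; lra.
by apply; rewrite ler_norml; apply/andP; split; lra.
Qed.

Lemma abs_summable_lin {c c' : I -> R[i]} (k : R[i]) :
  abs_summable c -> abs_summable c' ->
  abs_summable (fun i => k * c i + c' i).
Proof.
move=> sc sc'; apply: le_fin_bdd (fin_bddD (fin_bddZ (cmod_ge0 k) sc) sc') => i.
by rewrite -cmodM cmodD.
Qed.

Lemma tot_lin {c c' : I -> R[i]} (k : R[i]) :
  abs_summable c -> abs_summable c' ->
  tot (fun i => k * c i + c' i) = k * tot c + tot c'.
Proof.
by move=> sc sc'; apply: has_sum_tot; apply: has_sum_lin; apply: abs_summable_has_sum.
Qed.

Lemma has_sum_le {c} {x : R[i]} {M : R} : has_sum c x ->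
  (forall A, cmod (\sum_(i <- A) c i) <= M) -> cmod x <= M.
Proof.
move=> hc cM; apply/ler_addgt0Pr => eps e0.
have [A /(_ _ (fsubset_refl A)) hA] := hc _ e0.
have -> : x = \sum_(i <- A) c i - (\sum_(i <- A) c i - x) by ring.
by apply: le_trans (cmodD _ _) _; rewrite cmodN lerD.
Qed.

Lemma tot_le {c} {M : R} : (forall A, \sum_(i <- A) cmod (c i) <= M) ->
  cmod (tot c) <= M.
Proof.
move=> cM; apply: has_sum_le (abs_summable_has_sum _) _; first by exists M.
by move=> A; apply: le_trans (cmod_sum _ _) _.
Qed.

Lemma has_sum_unit {c} {i0 : I} : (forall i, i != i0 -> c i = 0) ->
  has_sum c (c i0).
Proof.
move=> c0 eps e0; exists [fset i0]%fset => B; rewrite fsub1set => iB.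
rewrite (bigD1_seq i0)//= big1_seq ?addr0 ?subrr ?cmod0 1?ltW//.
by move=> i /andP[/c0 ->].
Qed.

Lemma abs_summable_unit {c} {i0 : I} : (forall i, i != i0 -> c i = 0) ->
  abs_summable c.
Proof.
move=> c0; exists (cmod (c i0)) => A.
rewrite big_mkcond/=.
have [iA|iA] := boolP (i0 \in A).
  rewrite (bigD1_seq i0)//= big1_seq ?addr0//.
  by move=> i /andP[/c0 ->]; rewrite cmod0.
rewrite big1_seq ?cmod_ge0// => i /andP[_ iA'].
rewrite c0 ?cmod0//; apply: contraNneq iA => <-; exact: iA'.
Qed.

End FiniteSums.

(** * Double series as unordered sums *)

Section Blocks.
Context {R : realType} {m : nat -> nat}.
Implicit Types (a : idx m -> R) (c : idx m -> R[i]).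

(** The index set of the [n]-th partial sum of the double series. *)
Definition blocks (n : nat) : {fset idx m} :=
  [fset p in [seq @ix m j l | j <- iota 0 n, l <- index_enum 'I_(m j)]]%fset.

Lemma sum_blocks {V : zmodType} (F : idx m -> V) n :
  \sum_(p <- blocks n) F p = \sum_(0 <= j < n) \sum_(l < m j) F (ix l).
Proof.
pose s := [seq @ix m j l | j <- iota 0 n, l <- index_enum 'I_(m j)].
have us : uniq s.
  apply: allpairs_uniq_dep => [|j _|[j l] [j' l'] _ _ /= h //].
  - exact: iota_uniq.
  - exact: index_enum_uniq.
rewrite (perm_big s)/=; last first.
  by apply: uniq_perm => [||p]; [exact: fset_uniq|exact: us|rewrite inE].
by rewrite big_allpairs_dep/= /index_iota subn0.
Qed.

Lemma mem_blocks n p : (p \in blocks n) = (tag p < n)%N.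
Proof.
rewrite inE/=; apply/allpairsPdep/idP => [[j [l [+ _ ->]]]|pn].
  by rewrite mem_iota.
case: p pn => j l /= jn; exists j, l; split => //.
- by rewrite mem_iota.
- exact: mem_index_enum.
Qed.

Lemma blocks_mono {n n'} : (n <= n')%N -> (blocks n `<=` blocks n')%fset.
Proof.
move=> nn'; apply/fsubsetP => p; rewrite !mem_blocks => /leq_trans; exact.
Qed.

Lemma blocks_cofinal (A : {fset idx m}) : exists n, (A `<=` blocks n)%fset.
Proof.
exists (\max_(p <- A) tag p).+1; apply/fsubsetP => p pA.
by rewrite mem_blocks ltnS (leq_bigmax_seq _ pA).
Qed.

(** The sets [blocks n] are cofinal among the finite index sets, so bounded
partial sums over them bound all finite sums. *)
Lemma nneseries_fin_bdd {a} : (forall p, 0 <= a p) ->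
  ((\sum_(j <oo) (\sum_(l < m j) a (ix l))%R%:E < +oo)%E <-> fin_bdd a).
Proof.
move=> a0.
have b0 j : (0 <= (\sum_(l < m j) a (ix l))%R%:E)%E.
  by rewrite lee_fin sumr_ge0.
have bE n : (\sum_(0 <= j < n) (\sum_(l < m j) a (ix l))%R%:E)%E =
    (\sum_(p <- blocks n) a p)%:E by rewrite sumEFin sum_blocks.
split => [h|[M aM]].
  have fn : (\sum_(j <oo) (\sum_(l < m j) a (ix l))%R%:E)%E \is a fin_num.
    by rewrite ge0_fin_numE// nneseries_ge0.
  exists (fine (\sum_(j <oo) (\sum_(l < m j) a (ix l))%R%:E)%E) => A.
  have [n An] := blocks_cofinal A.
  apply: le_trans (fsum_mono a0 An) _.
  by rewrite -lee_fin -bE fineK//; apply: nneseries_lim_ge.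
apply: (@le_lt_trans _ _ M%:E); last exact: ltry.
apply: lime_le; first by apply: is_cvg_nneseries.
by apply: nearW => n; rewrite bE lee_fin.
Qed.

Lemma has_sum_has_dsum {c} {x : R[i]} : has_sum c x ->
  has_dsum (fun j (l : 'I_(m j)) => c (ix l)) x.
Proof.
move=> h; apply/cvgrPdist_le => e e0.
have [eE e0'] := gt0_complexE e0.
have [A hA] := h _ e0'; have [n An] := blocks_cofinal A.
exists n => // k /= nk; rewrite eE distrC cmod_norm lecR.
rewrite /dseries /series/= -sum_blocks.
by apply: hA; apply: fsubset_trans An (blocks_mono nk).
Qed.

Lemma has_dsum_unique {c : forall j, 'I_(m j) -> R[i]} {x y : R[i]} :
  has_dsum c x -> has_dsum c y -> x = y.
Proof. exact: (cvg_unique (@norm_hausdorff _ (R[i]^o : normedModType R[i]))). Qed.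

Lemma has_dsum_dsum {c : forall j, 'I_(m j) -> R[i]} {x : R[i]} :
  has_dsum c x -> dsum c = x.
Proof. exact: (cvg_lim (@norm_hausdorff _ (R[i]^o : normedModType R[i]))). Qed.

End Blocks.

(** * Alpha-duals and pairings *)

Section AlphaDual.
Context {R : realType} {I : countType}.
Implicit Types (V : set (I -> R[i])) (v a : I -> R[i]).

Lemma esum_fin_bdd (a : I -> R) : (forall i, 0 <= a i) ->
  ((\esum_(i in [set: I]) (a i)%:E < +oo)%E <-> fin_bdd a).
Proof.
move=> a0.
have aE (A : {fset I}) :
    (\sum_(i \in [set` A]) (a i)%:E)%E = (\sum_(i <- A) a i)%:E.
  by rewrite fsbig_finite//= set_fsetK sumEFin.
split => [h|[M aM]].
  have fn : (\esum_(i in [set: I]) (a i)%:E)%E \is a fin_num.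
    by rewrite ge0_fin_numE// esum_ge0// => i _; rewrite lee_fin.
  exists (fine (\esum_(i in [set: I]) (a i)%:E)%E) => A.
  by rewrite -lee_fin fineK// -aE; apply: esum_ge; exists [set` A].
apply: (@le_lt_trans _ _ M%:E); last exact: ltry.
apply: ge_ereal_sup => _ [X [finX _] <-].
by rewrite fsbig_finite//= sumEFin lee_fin.
Qed.

Lemma alpha_dualE V a :
  alpha_dual V a <-> forall v, V v -> abs_summable (fun i => v i * a i).
Proof.
have e v : (\esum_(i in [set: I]) (cmod (v i) * cmod (a i))%:E < +oo)%E <->
    abs_summable (fun i => v i * a i).
  rewrite esum_fin_bdd; last by move=> i; rewrite mulr_ge0 ?cmod_ge0.
  by rewrite /abs_summable; under [X in _ <-> fin_bdd X]eq_fun do rewrite cmodM.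
by split => h v /h /e.
Qed.

Lemma pairingE v a : pairing v a = tot (fun i => v i * a i).
Proof. by []. Qed.

Lemma pairingC v a : pairing v a = pairing a v.
Proof. by rewrite !pairingE; congr tot; apply/funext => i; rewrite mulrC. Qed.

Lemma sub_bidual V : V `<=` alpha_dual (alpha_dual V).
Proof.
move=> v Vv; apply/alpha_dualE => a /alpha_dualE /(_ v Vv).
by under eq_fun do rewrite mulrC.
Qed.

Lemma sequence_spaceP V : V 0 ->
    (forall (k : R[i]) u v, V u -> V v -> V (k *: u + v)) ->
  sequence_space V.
Proof.
move=> V0 VD; split; first exact/mem_set.
move=> k u v; rewrite -!topredE/= => /set_mem Vu /set_mem Vv.
exact/mem_set/VD.
Qed.

Lemma scaledE (k : R[i]) u v i : (k *: u + v) i = k * u i + v i.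
Proof. by []. Qed.

Lemma alpha_dual_space V : sequence_space (alpha_dual V).
Proof.
apply: sequence_spaceP => [|k a b /alpha_dualE Va /alpha_dualE Vb];
  apply/alpha_dualE => v Vv.
  exists 0 => A; rewrite big1// => i _.
  by rewrite (_ : (0 : I -> R[i]) i = 0)// mulr0 cmod0.
rewrite (_ : (fun i => _) = fun i => k * (v i * a i) + v i * b i).
  exact: abs_summable_lin (Va _ Vv) (Vb _ Vv).
by apply/funext => i; rewrite scaledE; ring.
Qed.

Lemma sequence_space_lin {V} (k : R[i]) u v : sequence_space V ->
  V u -> V v -> V (k *: u + v).
Proof.
move=> [_ VD] Vu Vv; apply/set_mem.
have := VD k u v; rewrite -!topredE/=; apply; exact/mem_set.
Qed.

Lemma pairing_linl {V a} (k : R[i]) u v : alpha_dual V a -> V u -> V v ->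
  pairing (k *: u + v) a = k * pairing u a + pairing v a.
Proof.
move=> /alpha_dualE Va /Va su /Va sv; rewrite !pairingE -tot_lin//.
by congr tot; apply/funext => i; rewrite scaledE; ring.
Qed.

Definition unit_fam (p : I) : I -> R[i] := fun q => (q == p)%:R.

Lemma unit_fam_id p : unit_fam p p = 1.
Proof. by rewrite /unit_fam eqxx. Qed.

Lemma unit_fam_neq p q : q != p -> unit_fam p q = 0.
Proof. by rewrite /unit_fam => /negbTE ->. Qed.

Lemma unit_fam_alpha V p : alpha_dual V (unit_fam p).
Proof.
apply/alpha_dualE => v _; apply: (@abs_summable_unit _ _ _ p) => q qp.
by rewrite unit_fam_neq// mulr0.
Qed.

Lemma pairing_unit v p : pairing v (unit_fam p) = v p.
Proof.
rewrite pairingE (@has_sum_tot _ _ _ (v p * unit_fam p p)).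
  by rewrite unit_fam_id mulr1.
apply: (@has_sum_unit _ _ (fun q => v q * unit_fam p q)) => q qp.
by rewrite unit_fam_neq// mulr0.
Qed.

End AlphaDual.

Arguments unit_fam {R I} p q : simpl never.

(** * Complex Banach spaces and uniform boundedness *)

Section RealNorm.
Context {R : realType} {V : normedModType R[i]}.
Implicit Types x y : V.

(** The norm of [V] takes its values in [R[i]]; this is the same norm as a real
number. *)
Definition rnorm x : R := complex.Re `|x|.

Lemma rnormE x : `|x| = (rnorm x)%:C%C.
Proof.
rewrite /rnorm; have := normr_ge0 x; case: `|x| => a b.
by rewrite lecE /= => /andP[/eqP ->].
Qed.

Lemma rnorm_ge0 x : 0 <= rnorm x.
Proof. by have := normr_ge0 x; rewrite rnormE ler0c. Qed.

Lemma rnorm0 : rnorm 0 = 0.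
Proof. by rewrite /rnorm normr0. Qed.

Lemma rnorm_eq0 x : rnorm x = 0 -> x = 0.
Proof. by move=> x0; apply/normr0_eq0; rewrite rnormE x0. Qed.

Lemma rnormD x y : rnorm (x + y) <= rnorm x + rnorm y.
Proof. by have := ler_normD x y; rewrite !rnormE -rmorphD lecR. Qed.

Lemma rnormZ (k : R[i]) x : rnorm (k *: x) = cmod k * rnorm x.
Proof.
by apply: complexI; rewrite -rnormE normrZ rnormE cmod_norm -rmorphM.
Qed.

Lemma rnorm_sum {J : Type} (s : seq J) (y : J -> V) :
  rnorm (\sum_(i <- s) y i) <= \sum_(i <- s) rnorm (y i).
Proof.
elim/big_rec2: _ => [|i y1 y2 _ ih]; first by rewrite rnorm0.
by rewrite (le_trans (rnormD _ _)) ?lerD2l.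
Qed.

End RealNorm.

Section Completeness.
Context {R : realType} {V : completeNormedModType R[i]}.

Lemma abs_convergent_series {y : nat -> V} {b : nat -> R} {M : R} :
    (forall k, rnorm (y k) <= b k) ->
    (forall n, \sum_(0 <= k < n) b k <= M) ->
  exists x, (forall eps, 0 < eps -> exists n, forall m, (n <= m)%N ->
                rnorm (x - \sum_(0 <= k < m) y k) <= eps) /\
            forall n, rnorm (x - \sum_(0 <= k < n) y k) <=
                      M - \sum_(0 <= k < n) b k.
Proof.
move=> yb bM.
have b0 k : 0 <= b k by apply: le_trans (yb k); exact: rnorm_ge0.
have yD n m : (n <= m)%N -> rnorm (\sum_(0 <= k < m) y k - \sum_(0 <= k < n) y k)
    <= \sum_(0 <= k < m) b k - \sum_(0 <= k < n) b k.
  move=> nm.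
  have splitE (W : zmodType) (F : nat -> W) :
      \sum_(0 <= k < m) F k - \sum_(0 <= k < n) F k = \sum_(n <= k < m) F k.
    by rewrite (big_cat_nat (n := n))//= addrAC subrr add0r.
  by rewrite !splitE; apply: le_trans (rnorm_sum _ _) _; apply: ler_sum => k _.
have cb : cvgn (series b).
  apply: nondecreasing_is_cvgn.
    by apply/nondecreasing_seqP => n; rewrite /series/= big_nat_recr//= lerDl.
  by exists M => _ [n _ <-]; exact: bM.
have cy : cvgn (series y).
  apply: cauchy_cvg; apply/cauchy_seriesP => e e0.
  have [eE e0'] := gt0_complexE e0.
  have cc : cauchy (series b @ \oo) by apply: cvg_cauchy; exact: cb.
  have := (@cauchy_seriesP _ R^o b).1 cc _ e0'.
  apply: filterS => -[n1 n2]/= h.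
  rewrite eE rnormE ltcR; apply: le_lt_trans h.
  apply: le_trans (rnorm_sum _ _) _; apply: le_trans (ler_norm _).
  by apply: ler_sum => k _.
have lim1 eps : 0 < eps -> exists n, forall m, (n <= m)%N ->
    rnorm (limn (series y) - \sum_(0 <= k < m) y k) <= eps.
  move=> e0; have /cvgrPdist_le/(_ eps%:C%C) := cy.
  rewrite ltcR => /(_ e0)[n _ h]; exists n => m /h /=.
  by rewrite rnormE lecR.
exists (limn (series y)); split => // n.
apply/ler_addgt0Pr => eps e0; have [n' hn] := lim1 _ e0.
pose m := maxn n n'.
have := hn m (leq_maxr _ _); have := yD n m (leq_maxl _ _); have := bM m.
set s := \sum_(0 <= k < m) y k; set s' := \sum_(0 <= k < n) y k.
have := rnormD (limn (series y) - s) (s - s').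
rewrite addrA subrK; lra.
Qed.

End Completeness.

Section UniformBoundedness.
Context {R : realType} {V : completeNormedModType R[i]}.

Let le_nat2X n : n%:R <= 2 ^+ n :> R.
Proof. by rewrite -natrX ler_nat ltnW// ltn_expl. Qed.

(** Banach-Steinhaus for functionals on a complex Banach space, by the gliding
hump in the form given by Sokal.  If the norms of the functionals were unbounded,
one could pick functionals [T (i n)] with bounds [S n >= 16 ^ n] and vectors [y n]
of the unit ball at which half of the bound is reached.  Add up the vectors with
the weights [8 ^- n], leaving out those that would make the value of the [n]-th
functional small.  The part of the sum after the [n]-th step has norm at most
[8 ^- n / 7], too small to cancel that value, so the values of the functionals at
the sum are unbounded. *)
Theorem uniform_boundedness {B : Type} {T : B -> V -> R[i]} :
    (forall i (k : R[i]) x y, T i (k *: x + y) = k * T i x + T i y) ->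
    (forall i, exists m, forall x, cmod (T i x) <= m * rnorm x) ->
    (forall x, exists M, forall i, cmod (T i x) <= M) ->
  exists C, forall i x, cmod (T i x) <= C * rnorm x.
Proof.
move=> Tlin Tbd Tpt; apply: contrapT => unbd.
have T0 i : T i 0 = 0.
  by have := Tlin i (-1) 0 0; rewrite scaler0 addr0 mulN1r addNr.
have TZ i k x : T i (k *: x) = k * T i x.
  by have := Tlin i k x 0; rewrite T0 !addr0.
have TD i x y : T i (x + y) = T i x + T i y.
  by have := Tlin i 1 x y; rewrite scale1r mul1r.
have TB i x y : T i (x - y) = T i x - T i y.
  by rewrite TD -scaleN1r TZ mulN1r.
have pick n : exists z : B * R * V, [/\ 16 ^+ n <= z.1.2,
    forall x, cmod (T z.1.1 x) <= z.1.2 * rnorm x,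
    rnorm z.2 <= 1 & z.1.2 / 2 <= cmod (T z.1.1 z.2)].
  (* doubling from [16 ^+ n], the first bound that holds is at most twice the
     operator norm *)
  pose P i k := forall x, cmod (T i x) <= 16 ^+ n * 2 ^+ k * rnorm x.
  have [i P0] : exists i, ~ P i 0%N.
    apply: contrapT => /forallNP h; apply: unbd; exists (16 ^+ n) => i x.
    have P0 : P i 0%N := contrapT (h i).
    by have := P0 x; rewrite expr0 mulr1.
  have [K PK] : exists k, P i k.
    have [m hm] := Tbd i; exists (Num.bound `|m|) => x.
    apply: le_trans (hm x) _; apply: ler_wpM2r; first exact: rnorm_ge0.
    have h1 : m <= 2 ^+ Num.bound `|m|.
      apply: le_trans (ler_norm m) _; apply: ltW.
      apply: lt_le_trans (archi_boundP (normr_ge0 m)) _.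
      by rewrite le_nat2X.
    apply: le_trans h1 _; rewrite ler_peMl ?exprn_ge0//.
    by rewrite exprn_ege1// ler1n.
  have [k nPk Pk] : exists2 k, ~ P i k & P i k.+1.
    elim: K PK => [//|k ih PK].
    by have [/ih//|nPk] := pselect (P i k); exists k.
  have /existsNP[x /negP] := nPk; rewrite -ltNge => hx.
  have x0 : 0 < rnorm x.
    rewrite lt_def rnorm_ge0 andbT; apply/eqP => /rnorm_eq0 x0.
    by move: hx; rewrite x0 T0 cmod0 rnorm0 mulr0 ltxx.
  exists (i, 16 ^+ n * 2 ^+ k.+1, ((rnorm x)^-1%:C)%C *: x) => /=; split => //.
  - by rewrite ler_peMr ?exprn_ge0// exprn_ege1// ler1n.
  - by rewrite rnormZ cmod_real ger0_norm ?invr_ge0 ?rnorm_ge0// mulVf ?lt0r_neq0.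
  - rewrite TZ cmodM cmod_real ger0_norm ?invr_ge0 ?rnorm_ge0//.
    by rewrite [leRHS]mulrC ler_pdivlMr// exprS; move: hx; lra.
have {pick}[z hz] := choice pick.
pose i n := (z n).1.1; pose S n := (z n).1.2; pose y n := (z n).2.
have S16 n : 16 ^+ n <= S n by case: (hz n).
have TS n x : cmod (T (i n) x) <= S n * rnorm x by case: (hz n) => _ + _ _; exact.
have y1 n : rnorm (y n) <= 1 by case: (hz n).
have yS n : S n / 2 <= cmod (T (i n) (y n)) by case: (hz n).
(* a ratio below 1/5 makes the tail smaller than the quarter kept at step [n], and
   a ratio above 1/16 makes [w n * S n] unbounded *)
pose w n : R := 8^-1 ^+ n.
have w0 n : 0 < w n by rewrite exprn_gt0.
pose step n x : V := if w n * S n / 4 <= cmod (T (i n) x) then 0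
                     else (w n)%:C%C *: y n.
pose part := fix part n := if n is n'.+1 then part n' + step n' (part n') else 0.
have stepw n x : rnorm (step n x) <= w n.
  rewrite /step; case: ifP => _; first by rewrite rnorm0 ltW.
  by rewrite rnormZ cmod_real gtr0_norm// ler_piMr// ltW.
have large n : w n * S n / 4 <= cmod (T (i n) (part n.+1)).
  rewrite /=/step; case: ifPn => [h|]; first by rewrite addr0.
  rewrite -ltNge TD TZ => h; set u := T _ (part n) in h *.
  have := cmodD (u + (w n)%:C%C * T (i n) (y n)) (- u).
  rewrite addrAC subrr add0r cmodN cmodM cmod_real gtr0_norm//.
  have := yS n; rewrite -(ler_pM2l (w0 n)); lra.
have partE n : \sum_(0 <= k < n) step k (part k) = part n.
  by elim: n => [|n ih]; [rewrite big_geq|rewrite big_nat_recr//= ih].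
have wsum n : \sum_(0 <= k < n) w k = 8 / 7 - w n * 8 / 7.
  elim: n => [|n ih]; first by rewrite big_geq// /w expr0; lra.
  by rewrite big_nat_recr//= ih /w exprS; lra.
have [n|x [_ hx]] := @abs_convergent_series _ _ (fun k => step k (part k)) w (8 / 7)
  (fun k => stepw k _).
  by rewrite wsum; have := w0 n; lra.
have [M hM] := Tpt x.
have low n : 2 ^+ n / 28 * 3 <= M.
  have := hx n.+1; rewrite partE wsum => tail.
  have := TS n (x - part n.+1); rewrite TB.
  have := cmodD (T (i n) x) (T (i n) (part n.+1) - T (i n) x).
  rewrite addrC subrK cmodB.
  have := hM (i n); have := large n.
  have S0 : 0 < S n by apply: lt_le_trans (S16 n); rewrite exprn_gt0.
  have wS : 2 ^+ n <= w n * S n.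
    apply: (@le_trans _ _ (w n * 16 ^+ n)).
      by rewrite /w -exprMn; apply: lerXn2r; rewrite ?nnegrE; lra.
    by rewrite ler_wpM2l// ltW.
  have : S n * rnorm (x - part n.+1) <= S n * (w n / 7).
    apply: ler_wpM2l; first exact: ltW.
    by move: tail; rewrite /w exprS; lra.
  move: wS; lra.
have M0 : 0 <= M by apply: le_trans (low 0%N); lra.
have := low (Num.bound (10 * M)).
have := archi_boundP (mulr_ge0 (ler0n R 10) M0).
have : (Num.bound (10 * M))%:R <= 2 ^+ Num.bound (10 * M) :> R.
  exact: le_nat2X.
lra.
Qed.

End UniformBoundedness.

(** * Coefficients with respect to an orthonormal basis *)

Section Coefficients.
Context {R : realType} {H : completeNormedModType R[i]}
  {dot : {dot H for Num.conj}} (dot_norm : inner_product_of_norm dot)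
  {m : nat -> nat} {e : idx m -> H} (e_basis : orthonormal_basis dot e).
Implicit Types (x y : H) (p q : idx m).

Lemma coef_lin (k : R[i]) x y :
  coef dot e (k *: x + y) = k *: coef dot e x + coef dot e y.
Proof. by apply/funext => p; rewrite /coef linearDl linearZl_LR. Qed.

Lemma coef_atP (k : R[i]) x y p :
  coef dot e (k *: x + y) p = k * coef dot e x p + coef dot e y p.
Proof. by rewrite coef_lin. Qed.

Lemma coef_at0 p : coef dot e 0 p = 0.
Proof. by rewrite /coef linear0l. Qed.

Lemma coef_atB x y p : coef dot e (x - y) p = coef dot e x p - coef dot e y p.
Proof. by rewrite /coef linearBl. Qed.

Lemma coef_atZ (k : R[i]) x p : coef dot e (k *: x) p = k * coef dot e x p.
Proof. by rewrite -[k *: x]addr0 coef_atP coef_at0 addr0. Qed.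

Lemma coef_at_sum (J : Type) (s : seq J) (x : J -> H) p :
  coef dot e (\sum_(i <- s) x i) p = \sum_(i <- s) coef dot e (x i) p.
Proof.
elim: s => [|i s ih]; first by rewrite !big_nil coef_at0.
by rewrite !big_cons -[x i]scale1r coef_atP ih mul1r scale1r.
Qed.

Lemma coef_basis p : coef dot e (e p) = unit_fam p.
Proof.
by apply/funext => q; rewrite /coef (proj1 e_basis) /unit_fam eq_sym.
Qed.

Lemma rnorm_basis p : rnorm (e p) = 1.
Proof.
have := dot_norm (e p); rewrite (proj1 e_basis) eqxx => /esym h.
apply/eqP; rewrite -(@eqrXn2 _ 2) ?rnorm_ge0//.
apply/eqP/complexI; rewrite rmorphXn/= -rnormE expr1n.
by rewrite h.
Qed.

(** Subtracting from [x] its component along [e p] lowers the square of the norm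
by the square of the modulus of the coefficient. *)
Lemma coef_le x p : cmod (coef dot e x p) <= rnorm x.
Proof.
set a := coef dot e x p.
have := dnorm_ge0 dot (x - a *: e p).
rewrite dnormB dnormZ linearZr_LR/= !dot_norm -/(coef dot e x p) -/a.
rewrite (rnormE (e p)) rnorm_basis expr1n mulr1 -normCKC.
rewrite geC0_conj ?exprn_ge0// opprD addrA addrK subr_ge0 => h.
rewrite -(@ler_pXn2r _ 2) ?nnegrE ?rnorm_ge0 ?cmod_ge0// -lecR !rmorphXn/=.
by rewrite -rnormE -cmod_norm.
Qed.

(** A vector orthogonal to [y] is at least as far from [y] as from [0]; by
density [y] may be taken to be a finite combination of basis vectors that is
arbitrarily close to [x]. *)
Lemma coef_eq0 x : (forall p, coef dot e x p = 0) -> x = 0.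
Proof.
move=> x0; apply: rnorm_eq0; apply/eqP; rewrite eq_le rnorm_ge0 andbT.
apply/ler_addgt0Pr => eps eps0; rewrite add0r.
have : closure [set y | exists (s : seq (idx m)) (c : idx m -> R[i]),
    y = \sum_(p <- s) c p *: e p] x by rewrite (proj2 e_basis).
have eps0' : 0 < eps%:C%C by rewrite ltcR.
move=> /(_ _ (nbhsx_ballx x _ eps0')) [_ [[s [c ->]] ]].
rewrite -ball_normE /ball_/= => xs.
set y := \sum_(p <- s) _ in xs.
have xy : dot x y = 0.
  rewrite /y linear_sumr/= big1_seq// => p _.
  by rewrite linearZr_LR/= [dot x (e p)]x0 mulr0.
have := dnormB dot x y; rewrite /= xy !dot_norm rmorph0 addr0 subr0 => h.
have {xs} : rnorm (x - y) < eps by rewrite -ltcR -rnormE.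
move=> /ltW; apply: le_trans.
rewrite -(@ler_pXn2r _ 2) ?nnegrE ?rnorm_ge0// -lecR !rmorphXn/= -!rnormE.
by rewrite h lerDl exprn_ge0.
Qed.

Lemma coef_inj x y : coef dot e x = coef dot e y -> x = y.
Proof.
move=> xy; apply/eqP; rewrite -subr_eq0; apply/eqP/coef_eq0 => p.
by rewrite coef_atB xy subrr.
Qed.

(** An absolutely summable family is the coefficient family of a vector, because
the series of its multiples of basis vectors converges absolutely. *)
Lemma coef_of_summable (c : idx m -> R[i]) (M : R) :
    (forall A : {fset idx m}, \sum_(p <- A) cmod (c p) <= M) ->
  exists2 x, coef dot e x = c & rnorm x <= M.
Proof.
move=> cM.
pose y j := \sum_(l < m j) c (ix l) *: e (ix l).
pose b j := \sum_(l < m j) cmod (c (ix l)).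
have yb j : rnorm (y j) <= b j.
  apply: le_trans (rnorm_sum _ _) _; apply: ler_sum => l _.
  by rewrite rnormZ rnorm_basis mulr1.
have bM n : \sum_(0 <= j < n) b j <= M by rewrite -(sum_blocks (fun p => cmod (c p))).
have [x [xlim xb]] := abs_convergent_series yb bM.
exists x; last first.
  by have := xb 0%N; rewrite !big_geq// !subr0.
apply/funext => p; apply/eqP; rewrite -subr_eq0; apply/eqP/cmod_eps0 => eps e0.
have [n hn] := xlim _ e0.
pose n' := maxn n (tag p).+1.
have {}hn := hn n' (leq_maxl _ _).
apply: le_trans hn; apply: le_trans (coef_le _ p).
rewrite coef_atB coef_at_sum.
have -> : \sum_(0 <= j < n') coef dot e (y j) p = c p; last by [].
under eq_bigr do rewrite /y coef_at_sum.
rewrite -(sum_blocks (fun q => coef dot e (c q *: e q) p)).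
under eq_bigr do rewrite coef_atZ coef_basis.
have pn : p \in blocks n' by rewrite mem_blocks leq_maxr.
rewrite (bigD1_seq p pn (fset_uniq _))/= unit_fam_id mulr1 big1_seq ?addr0// => q /andP[qp _].
by rewrite unit_fam_neq 1?eq_sym// mulr0.
Qed.

End Coefficients.

(** * Rapidly decreasing families *)

Section RapidDecay.
Context {R : realType} {m : nat -> nat} (lambda : nat -> R).
Implicit Types (c : idx m -> R[i]) (p : idx m) (s : R).

(** The coefficient families of smooth vectors, described by weighted [l^1]
conditions instead of weighted [l^2] ones. *)
Definition rapid : set (idx m -> R[i]) :=
  [set c | forall s, fin_bdd (fun p => lambda (tag p) `^ s * cmod (c p))].

Definition weight s : idx m -> R[i] := fun p => (lambda (tag p) `^ s)%:C%C.

Lemma cmod_weight s p : cmod (weight s p) = lambda (tag p) `^ s.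
Proof. by rewrite cmod_real ger0_norm ?powR_ge0. Qed.

Lemma rapid0 : rapid 0.
Proof.
by move=> s; exists 0 => A; rewrite big1// => p _; rewrite [cmod _]cmod0 mulr0.
Qed.

Lemma rapid_lin (k : R[i]) c c' : rapid c -> rapid c' -> rapid (k *: c + c').
Proof.
move=> rc rc' s.
apply: le_fin_bdd (fin_bddD (fin_bddZ (cmod_ge0 k) (rc s)) (rc' s)) => p.
rewrite mulrCA -mulrDr ler_wpM2l ?powR_ge0// -cmodM; exact: cmodD.
Qed.

Lemma rapid_space : sequence_space rapid.
Proof. by apply: sequence_spaceP rapid0 _ => k u v; exact: rapid_lin. Qed.

Lemma rapid_bounded_mul (M : R) c c' : 0 <= M ->
  (forall p, cmod (c' p) <= M * cmod (c p)) -> rapid c -> rapid c'.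
Proof.
move=> M0 c'c rc s; apply: le_fin_bdd (fin_bddZ M0 (rc s)) => p.
by rewrite mulrCA ler_wpM2l ?powR_ge0.
Qed.

Lemma rapid_summable c : (forall j, 0 < lambda j) -> rapid c -> abs_summable c.
Proof.
move=> l0 /(_ 0); apply: le_fin_bdd => p.
by rewrite powRr0 mul1r.
Qed.

Lemma rapid_weight_mul s c : (forall j, 0 < lambda j) ->
  rapid c -> rapid (fun p => weight s p * c p).
Proof.
move=> l0 rc s'; apply: le_fin_bdd (rc (s' + s)) => p.
rewrite cmodM cmod_weight mulrA -powRD//.
by rewrite (gt_eqF (l0 _)) implybT.
Qed.

Lemma rapid_unit p : rapid (unit_fam p).
Proof.
move=> s; have := @abs_summable_unit _ _ (fun q => weight s q * unit_fam p q) p.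
case=> [q qp|M hM]; first by rewrite unit_fam_neq// mulr0.
by exists M => A; apply: le_trans (hM A); apply: ler_sum => q _;
  rewrite cmodM cmod_weight.
Qed.

Lemma weight_alpha_dual s : alpha_dual rapid (weight s).
Proof.
apply/alpha_dualE => c /(_ s); apply: le_fin_bdd => p.
by rewrite cmodM cmod_weight mulrC.
Qed.

(** Rapidly decreasing families form a perfect space: the weights already lie
in the alpha-dual, and testing against them is the definition of [rapid]. *)
Lemma rapid_perfect : alpha_dual (alpha_dual rapid) `<=` rapid.
Proof.
move=> g /alpha_dualE gd s.
apply: le_fin_bdd (gd _ (weight_alpha_dual s)) => p.
by rewrite cmodM cmod_weight.
Qed.

End RapidDecay.

Section SmoothCoefficients.
Context {R : realType} {H : completeNormedModType R[i]}
  {dot : {dot H for Num.conj}} (dot_norm : inner_product_of_norm dot)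
  {m : nat -> nat} {e : idx m -> H} (e_basis : orthonormal_basis dot e)
  {lambda : nat -> R} (m_lambda : admissible_weights m lambda).

Lemma weight_fin_bdd : exists2 s0 : R, 0 < s0 &
  fin_bdd (fun p : idx m => lambda (tag p) `^ (- s0)).
Proof.
case: m_lambda => _ _ _ [s0 s00 h]; exists s0 => //.
apply/nneseries_fin_bdd => [p|]; first exact: powR_ge0.
rewrite (@eq_eseriesr _ _ (fun j => ((m j)%:R * lambda j `^ (- s0))%:E))//.
by move=> j _ /=; rewrite sumr_const card_ord mulr_natl.
Qed.

Let lambda_gt0 j : 0 < lambda j. Proof. by case: m_lambda. Qed.

Let smooth_fin_bdd x : smooth dot e lambda x <-> forall s,
  fin_bdd (fun p => lambda (tag p) `^ (2 * s) * cmod (coef dot e x p) ^+ 2).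
Proof.
have E s : (\sum_(j <oo) (lambda j `^ (2 * s) *
       \sum_(l < m j) cmod (coef dot e x (ix l)) ^+ 2)%R%:E < +oo)%E <->
    fin_bdd (fun p => lambda (tag p) `^ (2 * s) * cmod (coef dot e x p) ^+ 2).
  rewrite -nneseries_fin_bdd; last first.
    by move=> p; rewrite mulr_ge0 ?powR_ge0 ?exprn_ge0 ?cmod_ge0.
  by under eq_eseriesr do rewrite mulr_sumr.
by split => h s; apply/E.
Qed.

(** By [a b <= a ^ 2 + b ^ 2], where [b ^ 2] is a summable negative power of the
eigenvalues. *)
Lemma smooth_rapid x : smooth dot e lambda x -> rapid lambda (coef dot e x).
Proof.
move=> /smooth_fin_bdd sx s; have [s0 s00 w0] := weight_fin_bdd.
apply: le_fin_bdd (fin_bddD (sx (s + s0 / 2)) w0) => p.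
have l0 := lambda_gt0 (tag p).
set a := cmod _; set l := lambda _ in l0 *.
have powD r r' : l `^ (r + r') = l `^ r * l `^ r'.
  by rewrite powRD// (gt_eqF l0) implybT.
have -> : s = (s + s0 / 2) + (- (s0 / 2)) by ring.
have -> : 2 * (s + s0 / 2 + - (s0 / 2) + s0 / 2) =
  (s + s0 / 2) + (s + s0 / 2) by ring.
have -> : - s0 = - (s0 / 2) + - (s0 / 2) by lra.
rewrite !powD.
set u := l `^ s; set v := l `^ (s0 / 2); set w := l `^ (- (s0 / 2)).
have : 0 <= a * u * v by rewrite !mulr_ge0 ?powR_ge0 ?cmod_ge0.
have : 0 <= w by rewrite powR_ge0.
by have := sqr_ge0 (a * (u * v) - w); nra.
Qed.

Lemma rapid_smooth x : rapid lambda (coef dot e x) -> smooth dot e lambda x.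
Proof.
move=> rx; apply/smooth_fin_bdd => s.
have r0 p : 0 <= lambda (tag p) `^ s * cmod (coef dot e x p).
  by rewrite mulr_ge0 ?powR_ge0 ?cmod_ge0.
have [M M0 hM] := fin_bdd_term r0 (rx s).
apply: le_fin_bdd (fin_bddZ M0 (rx s)) => p.
apply: le_trans (ler_wpM2r (r0 p) (hM p)).
rewrite mulr_natl mulr2n powRD ?(gt_eqF (lambda_gt0 _)) ?implybT//.
by rewrite expr2 mulrACA.
Qed.

Lemma rapid_coef c : rapid lambda c ->
  exists2 x, smooth dot e lambda x & coef dot e x = c.
Proof.
move=> rc; have [M /(coef_of_summable dot_norm e_basis)[x xc _]] :=
  rapid_summable _ _ lambda_gt0 rc.
by exists x => //; apply: rapid_smooth; rewrite xc.
Qed.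

Lemma smooth_coefsE : smooth_coefs dot e lambda = rapid lambda.
Proof.
apply/seteqP; split => [_ [x /smooth_rapid + <-]//|c /rapid_coef[x sx <-]].
by exists x.
Qed.

Lemma smooth_lin (k : R[i]) x y : smooth dot e lambda x ->
  smooth dot e lambda y -> smooth dot e lambda (k *: x + y).
Proof.
move=> /smooth_rapid sx /smooth_rapid sy; apply: rapid_smooth.
by rewrite coef_lin; exact: rapid_lin.
Qed.

End SmoothCoefficients.

(** * Maps with sequential coordinates *)

Section CoordinatewiseSequential.
Context {R : realType} {H : completeNormedModType R[i]}
  {dot : {dot H for Num.conj}} (dot_norm : inner_product_of_norm dot)
  {d : nat -> nat} {e : idx d -> H} (e_basis : orthonormal_basis dot e)
  {lambda : nat -> R} (d_lambda : admissible_weights d lambda)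
  {J : countType} {W : set (J -> R[i])} {F : (idx d -> R[i]) -> J -> R[i]}
  (F_space : forall c, rapid lambda c -> W (F c))
  (F_linear : linear_on (rapid lambda) F)
  (F_coord : forall q, sequential_functional (rapid lambda) (fun c => F c q)).

Let lambda_gt0 j : 0 < lambda j. Proof. by case: d_lambda. Qed.

Section Functional.
Context {v : J -> R[i]} (Wv : alpha_dual W v).

Let L c := pairing (F c) v.

Let FZD (k : R[i]) u w : rapid lambda u -> rapid lambda w ->
  F (k *: u + w) = k *: F u + F w.
Proof. exact: F_linear. Qed.

Let L_linear (k : R[i]) u w : rapid lambda u -> rapid lambda w ->
  L (k *: u + w) = k * L u + L w.
Proof.
move=> ru rw; rewrite /L FZD//.
by apply: pairing_linl Wv _ _; apply: F_space.
Qed.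

Let L0 : L 0 = 0.
Proof.
have := L_linear (-1) _ _ (rapid0 lambda) (rapid0 lambda).
by rewrite scaler0 addr0 mulN1r addNr.
Qed.

Let a p := L (unit_fam p).

Lemma finite_part_rapid (c : idx d -> R[i]) u (s : seq (idx d)) : rapid lambda u ->
  rapid lambda (\sum_(p <- s) c p *: unit_fam p + u).
Proof.
move=> ru; elim: s => [|p s ih]; first by rewrite big_nil add0r.
by rewrite big_cons -addrA; apply: rapid_lin ih; exact: rapid_unit.
Qed.

Let L_finite_part (c : idx d -> R[i]) u (s : seq (idx d)) : rapid lambda u ->
  L (\sum_(p <- s) c p *: unit_fam p + u) = \sum_(p <- s) c p * a p + L u.
Proof.
move=> ru; elim: s => [|p s ih]; first by rewrite !big_nil !add0r.
rewrite !big_cons -!addrA L_linear ?ih//; first exact: rapid_unit.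
exact: finite_part_rapid.
Qed.

Lemma finite_partE (c : idx d -> R[i]) (A : {fset idx d}) q :
  (\sum_(p <- A) c p *: unit_fam p) q = if q \in A then c q else 0.
Proof.
have -> : forall s : seq (idx d), (\sum_(p <- s) c p *: unit_fam p) q =
    \sum_(p <- s) c p * unit_fam p q.
  by elim=> [|p s ih]; rewrite ?big_nil// !big_cons scaledE ih.
case: ifPn => qA.
  rewrite (bigD1_seq q qA (fset_uniq _))/= unit_fam_id mulr1 big1_seq ?addr0//.
  by move=> p /andP[pq _]; rewrite unit_fam_neq ?mulr0// eq_sym.
rewrite big1_seq// => p /andP[_ pA]; rewrite unit_fam_neq ?mulr0//.
by apply: contraNneq qA => ->.
Qed.

(** Multiplication by a rapidly decreasing family maps the whole Hilbert space
to rapidly decreasing families; it lets the completeness of [H] act on a space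
that is not normed. *)
Definition mulfam (c : idx d -> R[i]) (x : H) : idx d -> R[i] :=
  fun p => c p * coef dot e x p.

Section Multiplier.
Context {c : idx d -> R[i]} (rc : rapid lambda c).

Lemma mulfam_rapid x : rapid lambda (mulfam c x).
Proof.
apply: rapid_bounded_mul (rnorm_ge0 x) _ rc => p.
by rewrite cmodM mulrC ler_wpM2r ?cmod_ge0// (coef_le dot_norm e_basis).
Qed.

Lemma mulfam_lin (k : R[i]) x y :
  mulfam c (k *: x + y) = k *: mulfam c x + mulfam c y.
Proof. by apply/funext => p; rewrite scaledE /mulfam coef_atP; ring. Qed.

(** The summand [0] gives the right-hand side the shape to which linearity
applies. *)
Lemma mulfam_basis p : mulfam c (e p) = c p *: unit_fam p + 0.
Proof.
apply/funext => q; rewrite scaledE /mulfam (coef_basis e_basis) addr0.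
have [->//|qp] := eqVneq q p.
by rewrite unit_fam_neq// !mulr0.
Qed.

(** Here uniform boundedness enters: [x |-> L (mulfam c x)] is a pointwise limit
of its partial sums over [J], which are bounded functionals on [H] because the
coordinates of [F] are sequential. *)
Lemma L_mulfam_bounded :
  exists2 C, 0 <= C & forall x, cmod (L (mulfam c x)) <= C * rnorm x.
Proof.
pose T (A : {fset J}) x := \sum_(q <- A) F (mulfam c x) q * v q.
have Tlin A (k : R[i]) x y : T A (k *: x + y) = k * T A x + T A y.
  rewrite /T mulr_sumr -big_split/=; apply: eq_bigr => q _.
  by rewrite mulfam_lin FZD ?scaledE; [ring|exact: mulfam_rapid..].
have Fbd q : exists M, forall x, cmod (F (mulfam c x) q) <= M * rnorm x.
  have [t /alpha_dualE /(_ _ rc)[M tM] Ft] := F_coord q.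
  exists M => x; rewrite Ft ?pairingE; last exact: mulfam_rapid.
  apply: tot_le => A; apply: le_trans (ler_wpM2r (rnorm_ge0 x) (tM A)).
  rewrite mulr_suml; apply: ler_sum => p _; rewrite !cmodM -!mulrA ler_wpM2l//.
    exact: cmod_ge0.
  by rewrite mulrC ler_wpM2l ?cmod_ge0// (coef_le dot_norm e_basis).
have [M FM] := choice Fbd.
have Tbd A : exists M, forall x, cmod (T A x) <= M * rnorm x.
  exists (\sum_(q <- A) M q * cmod (v q)) => x.
  apply: le_trans (cmod_sum _ _) _; rewrite mulr_suml; apply: ler_sum => q _.
  by rewrite cmodM mulrAC ler_wpM2r ?cmod_ge0.
have sumF x : abs_summable (fun q => F (mulfam c x) q * v q).
  by move/alpha_dualE : Wv; apply; apply: F_space; exact: mulfam_rapid.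
have Tpt x : exists M, forall A, cmod (T A x) <= M.
  have [N hN] := sumF x; exists N => A.
  by apply: le_trans (cmod_sum _ _) _; exact: hN.
have [C hC] := uniform_boundedness Tlin Tbd Tpt.
exists `|C| => // x.
apply: has_sum_le (abs_summable_has_sum (sumF x)) _ => A.
by apply: le_trans (hC A x) _; rewrite ler_wpM2r ?rnorm_ge0// ler_norm.
Qed.

End Multiplier.

(** Write [c] as [lambda ^ (- s0)] times [w], with [s0] such that the power is
summable.  Then [c] minus its part on a finite set [B] is [mulfam w x] for the
vector [x] with coefficients [lambda ^ (- s0)] outside [B], whose norm is at most
a tail of a convergent series.  So boundedness of [L] along [mulfam w] makes the
finite parts converge to [L c].  Applied to the basis vectors, the same bound
gives absolute summability. *)
Lemma L_represented c : rapid lambda c ->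
  abs_summable (fun p => c p * a p) /\ has_sum (fun p => c p * a p) (L c).
Proof.
move=> rc; have [s0 s00 w0] := weight_fin_bdd d_lambda.
pose w p := weight lambda s0 p * c p.
have rw : rapid lambda w by exact: rapid_weight_mul.
have [C C0 hC] := L_mulfam_bounded rw.
have wN p : weight lambda (- s0) p * weight lambda s0 p = 1.
  rewrite /weight -rmorphM -powRD ?addNr ?powRr0//.
  by rewrite (gt_eqF (lambda_gt0 _)) implybT.
have cw p : c p = weight lambda (- s0) p * w p by rewrite mulrA wN mul1r.
split.
  apply: le_fin_bdd (fin_bddZ C0 w0) => p.
  rewrite cw -mulrA cmodM cmod_weight mulrC ler_wpM2r ?powR_ge0//.
  have := hC (e p); rewrite (rnorm_basis dot_norm e_basis) mulr1 mulfam_basis.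
  by rewrite L_linear ?L0 ?addr0//; [exact: rapid_unit|exact: rapid0].
move=> eps eps0.
have C1 : 0 < C + 1 by rewrite ltr_wpDl.
have [A hA] := fin_bdd_tail (fun p => powR_ge0 _ _) w0 _ (divr_gt0 eps0 C1).
exists A => B AB.
(* the part of [c] outside [B] is [w] times the coefficients of a short vector *)
pose r p := if p \in B then 0 else weight lambda (- s0) p.
have [D|x xr xe] := @coef_of_summable _ _ _ dot_norm _ _ e_basis r (eps / (C + 1)).
  apply: le_trans (hA B AB D); apply: ler_sum => p _; rewrite /r.
  by case: ifP; rewrite ?cmod0 ?cmod_weight.
have cE : c = \sum_(p <- B) c p *: unit_fam p + mulfam w x.
  apply/funext => q; rewrite -[RHS]/(_ q + _ q) finite_partE /mulfam xr /r.
  case: ifP => _; first by rewrite mulr0 addr0.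
  by rewrite add0r mulrC -cw.
rewrite [in L c]cE L_finite_part; last exact: mulfam_rapid.
rewrite opprD addrA subrr add0r cmodN; apply: le_trans (hC x) _.
apply: le_trans (ler_wpM2l C0 xe) _.
rewrite mulrA ler_pdivrMr// mulrC ler_pM2l//; lra.
Qed.

End Functional.

(** The content is the interchange of the sum over [J] that defines the pairing
with [v] and the sum over [idx d] that expands [c] in unit families. *)
Theorem coordinatewise_sequential {v} : alpha_dual W v ->
  sequential_functional (rapid lambda) (fun c => pairing (F c) v).
Proof.
move=> Wv; exists (fun p => pairing (F (unit_fam p)) v).
  by apply/alpha_dualE => c /(L_represented Wv)[].
by move=> c /(L_represented Wv)[_ /has_sum_tot <-].
Qed.

End CoordinatewiseSequential.

(** * Adjoints of sequential maps *)

Section Adjoint.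
Context {R : realType} {I J : countType} {V : set (I -> R[i])}
  {W : set (J -> R[i])} {F : (I -> R[i]) -> J -> R[i]}
  (F_seq : sequential_map V W F).

Lemma adjointP {v} : alpha_dual W v ->
  alpha_dual V (adjoint V F v) /\
  forall c, V c -> pairing (F c) v = pairing c (adjoint V F v).
Proof.
case: F_seq => _ _ _ /[apply] -[a Va aF].
have := @xgetPex _ (0 : I -> R[i]) [set a | alpha_dual V a /\
  forall c, V c -> pairing (F c) v = pairing c a].
by apply; exists a.
Qed.

(** The values of [adjoint F v] are read off by testing against unit families. *)
Lemma adjoint_coord v p : alpha_dual W v -> V (unit_fam p) ->
  adjoint V F v p = pairing (F (unit_fam p)) v.
Proof.
by move=> /adjointP[_ aF] Vp; rewrite aF// pairingC pairing_unit.
Qed.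

(** When the domain is perfect, a functional in the second alpha-dual of [V] is
pairing with some [c] in [V]; its composite with the adjoint is pairing with
[F c], which lies in the second alpha-dual of [W]. *)
Lemma adjoint_sequential :
    (forall p, V (unit_fam p)) -> alpha_dual (alpha_dual V) `<=` V ->
  sequential_map (alpha_dual W) (alpha_dual V) (adjoint V F).
Proof.
move=> Vunit Vperf; have [_ VW _ _] := F_seq.
split=> [|v /adjointP[]//|k v w Wv Ww|c /Vperf Vc].
- by split; exact: alpha_dual_space.
- apply/funext => p; rewrite scaledE !adjoint_coord//; last first.
    exact: sequence_space_lin (alpha_dual_space W) Wv Ww.
  rewrite !(pairingC (F _)); apply: pairing_linl Wv Ww.
  exact/sub_bidual/VW.
exists (F c); first exact/sub_bidual/VW.
by move=> v /adjointP[_ aF]; rewrite pairingC -aF// pairingC.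
Qed.

End Adjoint.

(** * Sequential maps between spaces of smooth vectors *)

Theorem theorem4p9 (R : realType)
  (H : completeNormedModType R[i]) (dotH : {dot H for Num.conj})
  (dotH_norm : inner_product_of_norm dotH)
  (d : nat -> nat) (e : idx d -> H) (e_basis : orthonormal_basis dotH e)
  (lambda : nat -> R) (d_lambda : admissible_weights d lambda)
  (G : completeNormedModType R[i]) (dotG : {dot G for Num.conj})
  (dotG_norm : inner_product_of_norm dotG)
  (g : nat -> nat) (h : idx g -> G) (h_basis : orthonormal_basis dotG h)
  (mu : nat -> R) (g_mu : admissible_weights g mu)
  (f : H -> G)
  (f_smooth : forall u, smooth dotH e lambda u -> smooth dotG h mu (f u))
  (f_linear : linear_on (smooth dotH e lambda) f) :
  let HE := smooth dotH e lambda in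
  let VH := smooth_coefs dotH e lambda in
  let VG := smooth_coefs dotG h mu in
  let F := on_coefs dotH e lambda dotG h f in
  let Fhat := adjoint VH F in
  let tensor := forall k j : nat, 'I_(d j) -> 'I_(g k) -> R[i] in
  let represents (t : tensor) :=
    [/\ forall u, HE u -> forall k (i : 'I_(g k)),
          has_dsum (fun j (l : 'I_(d j)) => t k j l i * coef dotH e u (ix l))
                   (coef dotG h (f u) (ix i)),
        forall u, HE u -> forall k (i : 'I_(g k)),
          dsum_finite (fun j (l : 'I_(d j)) =>
            cmod (t k j l i) * cmod (coef dotH e u (ix l)))
      & forall u v, HE u -> alpha_dual VG v ->
          dsum_finite (fun k (i : 'I_(g k)) =>
            cmod (v (ix i)) *
            cmod (dsum (fun j (l : 'I_(d j)) =>
                          t k j l i * coef dotH e u (ix l))))] in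
  (sequential_map VH VG F <-> exists t : tensor, represents t) /\
  (forall t : tensor, represents t ->
    [/\ sequential_map (alpha_dual VG) (alpha_dual VH) Fhat,
        forall v, alpha_dual VG v -> forall j (l : 'I_(d j)),
          has_dsum (fun k (i : 'I_(g k)) => t k j l i * v (ix i))
                   (Fhat v (ix l))
      & forall u v, HE u -> alpha_dual VG v ->
          pairing (coef dotG h (f u)) v = pairing (coef dotH e u) (Fhat v)]).
Proof.
move=> HE VH VG F Fhat tensor represents.
have VHE : VH = rapid lambda by apply: smooth_coefsE.
have Fcoef u : HE u -> F (coef dotH e u) = coef dotG h (f u).
  move=> HEu; rewrite /F /on_coefs.
  have := @xgetPex _ (0 : H) [set u' | smooth dotH e lambda u' /\
    coef dotH e u' = coef dotH e u].
  by move=> /(_ (ex_intro _ u (conj HEu erefl)))[_ /(coef_inj dotH_norm e_basis) ->].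
have VHu c : rapid lambda c -> exists2 u, HE u & coef dotH e u = c.
  exact: rapid_coef.
have F_space c : rapid lambda c -> VG (F c).
  by move=> /VHu[u HEu <-]; rewrite Fcoef//; exists (f u) => //; exact: f_smooth.
have F_lin : linear_on (rapid lambda) F.
  move=> k _ _ /VHu[u HEu <-] /VHu[w HEw <-].
  rewrite -coef_lin !Fcoef//; last exact: smooth_lin.
  by rewrite f_linear// coef_lin.
have spaces : sequence_space VH /\ sequence_space VG.
  rewrite VHE; split; first exact: rapid_space.
  rewrite /VG (smooth_coefsE dotG_norm h_basis g_mu); exact: rapid_space.
pose row (t : tensor) (q : idx g) : idx d -> R[i] :=
  fun p => t (tag q) (tag p) (tagged p) (tagged q).
have row_dual t : represents t -> forall q, alpha_dual VH (row t q).
  move=> [_ tfin _] q; apply/alpha_dualE => _ [u HEu <-].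
  have h0 p : 0 <= cmod (row t q p) * cmod (coef dotH e u p).
    by rewrite mulr_ge0 ?cmod_ge0.
  have := (nneseries_fin_bdd h0).1 (tfin u HEu (tag q) (tagged q)).
  by apply: le_fin_bdd => p; rewrite cmodM mulrC.
(* both the ordered double series and the unordered sum converge to the pairing *)
have row_sum t : represents t -> forall q u, HE u ->
    coef dotG h (f u) q = pairing (coef dotH e u) (row t q).
  move=> rt [k i] u HEu; have [tsum _ _] := rt.
  apply: has_dsum_unique (tsum u HEu k i) _; rewrite pairingE.
  have /alpha_dualE/(_ (coef dotH e u)) := row_dual t rt (ix i).
  move=> /(_ (ex_intro2 _ _ u HEu erefl))/abs_summable_has_sum.
  rewrite (_ : (fun p => _) = fun p => row t (ix i) p * coef dotH e u p).
    exact: has_sum_has_dsum.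
  by apply/funext => p; rewrite mulrC.
have represents_sequential t : represents t -> sequential_map VH VG F.
  move=> rt; split => //; rewrite ?VHE// => v VGv.
  apply: (coordinatewise_sequential dotH_norm e_basis d_lambda F_space F_lin _ VGv).
  move=> q; exists (row t q); first by rewrite -VHE; exact: row_dual.
  by move=> _ /VHu[u HEu <-]; rewrite Fcoef// (row_sum t).
split; first split.
(* testing against unit families makes each coordinate of [f] a functional in
   the alpha-dual; these are the rows of the tensor *)
- case=> _ _ _ Fseq.
  have rows q : exists a, alpha_dual VH a /\
      forall u, HE u -> coef dotG h (f u) q = pairing (coef dotH e u) a.
    have [a Va aF] := Fseq _ (unit_fam_alpha VG q).
    exists a; split => // u HEu.
    by rewrite -aF; [rewrite pairing_unit Fcoef|exists u].
  have [a /all_and2[Va aF]] := choice rows.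
  exists (fun k j l i => a (ix i) (ix l)).
  have sumu q u : HE u -> abs_summable (fun p => a q p * coef dotH e u p).
    move=> HEu; have /alpha_dualE/(_ (coef dotH e u)) := Va q.
    move=> /(_ (ex_intro2 _ _ u HEu erefl)).
    by apply: le_fin_bdd => p; rewrite mulrC.
  have dsumu u k (i : 'I_(g k)) : HE u ->
      has_dsum (fun j (l : 'I_(d j)) => a (ix i) (ix l) * coef dotH e u (ix l))
               (coef dotG h (f u) (ix i)).
    move=> HEu; rewrite aF// pairingC pairingE.
    have := has_sum_has_dsum (abs_summable_has_sum (sumu (ix i) u HEu)).
    exact.
  split=> [u HEu k i|u HEu k i|u v HEu VGv]; first exact: dsumu.
    apply/(@nneseries_fin_bdd R d
      (fun p => cmod (a (ix i) p) * cmod (coef dotH e u p))) => [p|].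
      by rewrite mulr_ge0 ?cmod_ge0.
    by apply: le_fin_bdd (sumu (ix i) u HEu) => p; rewrite cmodM.
  rewrite /dsum_finite.
  under eq_eseriesr => k _.
    under eq_bigr => i _ do rewrite (has_dsum_dsum (dsumu u k i HEu)).
    over.
  apply/(@nneseries_fin_bdd R g
    (fun q => cmod (v q) * cmod (coef dotG h (f u) q))) => [q|].
    by rewrite mulr_ge0 ?cmod_ge0.
  move/alpha_dualE : VGv => /(_ (coef dotG h (f u))).
  move=> /(_ (ex_intro2 _ _ (f u) (f_smooth _ HEu) erefl)).
  by apply: le_fin_bdd => q; rewrite cmodM mulrC.
- by case=> t; exact: represents_sequential.
move=> t rt; have Fseq := represents_sequential t rt.
have VHunit p : VH (unit_fam p) by rewrite VHE; exact: rapid_unit.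
split=> [|v VGv j l|u v HEu VGv].
- by apply: adjoint_sequential => //; rewrite VHE; exact: rapid_perfect.
- have VGp := F_space _ (rapid_unit lambda (ix l)).
  rewrite /Fhat (adjoint_coord Fseq)// pairingE.
  have /alpha_dualE/(_ _ VGp)/abs_summable_has_sum := VGv.
  rewrite (_ : (fun q => _) = fun q => row t q (ix l) * v q).
    exact: has_sum_has_dsum.
  apply/funext => q; congr (_ * _).
  have [u HEu uE] := VHu _ (rapid_unit lambda (ix l)).
  by rewrite -uE Fcoef// (row_sum t)// uE pairingC pairing_unit.
- by rewrite -(proj2 (adjointP Fseq VGv)) ?Fcoef//; exists u.
Qed.
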